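(* Let $\Lambda=KQ/I$ be a string algebra such that at each vertex of $Q$ there are at most three arrows (i.e. every vertex of $Q$ has degree at most three). Then $\Lambda$ admits a maximal green sequence.
   Context: $K$ is an algebraically closed field, $Q=(Q_0,Q_1)$ is a finite quiver, and $\Lambda=KQ/I$ is finite dimensional. Paths are written left to right, so $\alpha\beta$ means first $\alpha$ then $\beta$. The degree of a vertex is the number of arrows starting at it plus the number of arrows ending at it (a loop counts twice). $\Lambda$-mod is the category of finitely generated $\Lambda$-modules. String algebra: $I$ is an admissible ideal generated by paths, and (S1) every vertex has at most two incoming and at most two outgoing arrows; (S2) for every arrow $\alpha$ there is at most one arrow $\beta$ with $\alpha\beta\notin I$ and at most one arrow $\gamma$ with $\gamma\alpha\notin I$. Maximal green sequence: a torsion class is a full subcategory of $\Lambda$-mod closed under extensions and quotients; torsion classes, ordered by inclusion, form a complete lattice $\mathsf{tors}\,\Lambda$. A maximal green sequence for $\Lambda$ is a finite maximal chain in $\mathsf{tors}\,\Lambda$. By a theorem of Demonet and Keller these are in bijection with finite complete forward hom-orthogonal sequences, i.e. finite sequences of (isomorphism classes of) bricks $M_1,\dots,M_k$ (modules whose endomorphism algebra is a division algebra) with $\operatorname{Hom}_\Lambda(M_i,M_j)=0$ for all $i<j$ that cannot be refined by inserting further bricks while preserving this condition; the two notions are used interchangeably. *)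

(* Defs.v *)
From HB Require Import structures.
From mathcomp Require Import all_boot all_order all_algebra.
From mathcomp Require Import generic_quotient ring_quotient finmap.
From mathcomp.multinomials Require Import monalg.

Set Implicit Arguments.
Unset Strict Implicit.
Unset Printing Implicit Defensive.

Import GRing.Theory.

Local Open Scope ring_scope.
Local Open Scope quotient_scope.

Definition two_sided_absorbing (R : pzRingType) (S : {pred R}) : Prop :=
  forall a x b, x \in S -> a * x * b \in S.

HB.mixin Record isTwoSidedAbsorbing (R : pzRingType) (S : R -> bool) := {
  two_sided_absorbing_subproof : two_sided_absorbing S
}.

(* The library's [idealr] is one-sided, proper, and lives in nonzero rings. *)
#[short(type="twoSidedIdeal")]
HB.structure Definition TwoSidedIdeal (R : pzRingType) :=
  {S of GRing.ZmodClosed R S & isTwoSidedAbsorbing R S}.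

Section QuotientRing.
Variables (R : pzRingType) (I : twoSidedIdeal R).

Definition quotient_ring : Type := Quotient.quot I.

HB.instance Definition _ := GRing.Zmodule.on quotient_ring.
HB.instance Definition _ := ZmodQuotient.on quotient_ring.

Definition qone : quotient_ring := \pi_quotient_ring 1.
Definition qmul (x y : quotient_ring) : quotient_ring :=
  \pi_quotient_ring (repr x * repr y).

Lemma ideal_absorb (a x b : R) : x \in I -> a * x * b \in I.
Proof. exact: two_sided_absorbing_subproof. Qed.

Lemma qpiE (x y : R) :
  (\pi_quotient_ring x = \pi_quotient_ring y) <-> (x - y \in I).
Proof. by rewrite Quotient.idealrBE; split=> [/eqP|/eqP]. Qed.

Lemma pi_qmul (x y : R) :
  qmul (\pi_quotient_ring x) (\pi_quotient_ring y) = \pi_quotient_ring (x * y).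
Proof.
apply/qpiE; set x' := repr _; set y' := repr _.
have hx : x' - x \in I by apply/qpiE; rewrite reprK.
have hy : y' - y \in I by apply/qpiE; rewrite reprK.
have -> : x' * y' - x * y = 1 * (x' - x) * y' + x * (y' - y) * 1.
  by rewrite mul1r mulr1 mulrBl mulrBr addrA subrK.
by rewrite rpredD // ideal_absorb.
Qed.

Lemma pi_qadd (x y : R) :
  \pi_quotient_ring x + \pi_quotient_ring y = \pi_quotient_ring (x + y).
Proof. by rewrite [RHS]Quotient.pi_add. Qed.

Lemma qmulA : associative qmul.
Proof.
by elim/quotW=> x; elim/quotW=> y; elim/quotW=> z; rewrite (pi_qmul y z) (pi_qmul x y)
  (pi_qmul x) (pi_qmul _ z) mulrA.
Qed.

Lemma qmul1 : left_id qone qmul.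
Proof. by elim/quotW=> x; rewrite pi_qmul mul1r. Qed.

Lemma qmulr1 : right_id qone qmul.
Proof. by elim/quotW=> x; rewrite pi_qmul mulr1. Qed.

Lemma qmulDl : left_distributive qmul +%R.
Proof.
elim/quotW=> x; elim/quotW=> y; elim/quotW=> z.
by rewrite (pi_qmul x) (pi_qmul y) !pi_qadd (pi_qmul _ z) mulrDl.
Qed.

Lemma qmulDr : right_distributive qmul +%R.
Proof.
elim/quotW=> x; elim/quotW=> y; elim/quotW=> z.
by rewrite (pi_qmul _ y) (pi_qmul _ z) !pi_qadd (pi_qmul x) mulrDr.
Qed.

HB.instance Definition _ := GRing.Zmodule_isPzRing.Build quotient_ring
  qmulA qmul1 qmulr1 qmulDl qmulDr.

End QuotientRing.

Definition ideal_generated (R : pzRingType) (G : R -> Prop) (x : R) : Prop :=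
  forall J : twoSidedIdeal R, (forall g, G g -> g \in J) -> x \in J.

Definition ideal_power (R : pzRingType) (J : R -> Prop) (m : nat) : R -> Prop :=
  ideal_generated (fun x => exists f : 'I_m -> R,
    (forall i, J (f i)) /\ x = \prod_(i < m) f i).

Record quiver := Quiver {
  vertex : finType;
  arrow : finType;
  source : arrow -> vertex;
  target : arrow -> vertex
}.

Section PathAlgebra.
Variable (Q : quiver).

Fixpoint is_walk (v : vertex Q) (p : seq (arrow Q)) : bool :=
  if p is a :: p' then (source a == v) && is_walk (target a) p' else true.

(* A path is its starting vertex with its list of arrows, read left to right;
   the trivial path e_v is (v, [::]). *)
Definition qpath : Type :=
  {x : vertex Q * seq (arrow Q) | is_walk x.1 x.2}.
HB.instance Definition _ := Countable.on qpath.
HB.instance Definition _ := SubType.on qpath.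

Definition pstart (p : qpath) : vertex Q := (val p).1.
Definition parrows (p : qpath) : seq (arrow Q) := (val p).2.
Definition pend (p : qpath) : vertex Q :=
  last (pstart p) (map (@target Q) (parrows p)).

Lemma is_walk_cat v p q :
  is_walk v (p ++ q) =
  is_walk v p && is_walk (last v (map (@target Q) p)) q.
Proof. by elim: p v => //= a p IHp v; rewrite IHp andbA. Qed.

Definition trivial_path (v : vertex Q) : qpath :=
  exist (fun x : vertex Q * seq (arrow Q) => is_walk x.1 x.2)
    (v, [::]) isT.

Lemma arrow_path_subproof (a : arrow Q) : is_walk (source a) [:: a].
Proof. by rewrite /= eqxx. Qed.

Definition arrow_path (a : arrow Q) : qpath :=
  exist (fun x : vertex Q * seq (arrow Q) => is_walk x.1 x.2)
    (source a, [:: a]) (arrow_path_subproof a).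

(* [None] when p does not end where q starts. *)
Definition pcat (p q : qpath) : option qpath :=
  if pend p == pstart q then (insub (pstart p, parrows p ++ parrows q) : option qpath) else None.

Variant pcat_spec (p q : qpath) : option qpath -> Prop :=
| PcatSome r of pend p = pstart q & pstart r = pstart p & pend r = pend q
    & parrows r = parrows p ++ parrows q : pcat_spec p q (Some r)
| PcatNone of pend p != pstart q : pcat_spec p q None.

Lemma pcatP p q : pcat_spec p q (pcat p q).
Proof.
rewrite /pcat; case: eqP => [e|/eqP]; last by constructor.
case: insubP => [r _ er|/negP[]] /=.
  have [es ea] : pstart r = pstart p /\ parrows r = parrows p ++ parrows q.
    by rewrite /pstart /parrows er.
  constructor=> //; rewrite /pend ea es map_cat last_cat.
  by rewrite -[last (pstart p) _]/(pend p) e.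
rewrite is_walk_cat -[last _ _]/(pend p) e.
by rewrite (valP p) (valP q).
Qed.

Lemma qpath_eq p q : pstart p = pstart q -> parrows p = parrows q -> p = q.
Proof.
case: p => [[v s] hp]; case: q => [[w t] hq]; rewrite /pstart /parrows /=.
by move=> ev es; apply: val_inj; rewrite /= ev es.
Qed.

Lemma pcatA p q r :
  obind (fun s => pcat s r) (pcat p q) = obind (pcat p) (pcat q r).
Proof.
case: (pcatP p q) => [s e1 s1 s2 s3|n1] /=; case: (pcatP q r) => [t e2 t1 t2 t3|n2] /=.
- case: pcatP => [u f1 f2 f3 f4|]; last by rewrite s2 e2 eqxx.
  case: pcatP => [w g1 g2 g3 g4|]; last by rewrite t1 e1 eqxx.
  by congr Some; apply: qpath_eq; rewrite ?f2 ?g2 // f4 g4 s3 t3 catA.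
- by case: pcatP => // u; rewrite s2 => f1; rewrite f1 eqxx in n2.
- by case: pcatP => // u; rewrite t1 => f1; rewrite f1 eqxx in n1.
- by [].
Qed.

Variable (K : fieldType).

(* {malg K[X]} is the K-space of finitely supported functions X -> K; its own
   ring structure would need a monoid X, so the product is defined below. *)
Definition path_algebra : Type := {malg K[qpath]}.
HB.instance Definition _ := GRing.Lmodule.on path_algebra.

Definition path_elt (p : qpath) : path_algebra := << p >>.

Definition path_mul (p q : qpath) : path_algebra :=
  if pcat p q is Some r then path_elt r else 0.

Definition pa_one : path_algebra := \sum_(v : vertex Q) path_elt (trivial_path v).
Definition pa_mul (x y : path_algebra) : path_algebra :=
  \sum_(p <- msupp x) \sum_(q <- msupp y) (x@_p * y@_q) *: path_mul p q.

Implicit Types (x y z : path_algebra).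
Local Open Scope fset_scope.
Local Open Scope ring_scope.

Lemma pa_mulw (d1 d2 : {fset qpath}) x y :
  msupp x `<=` d1 -> msupp y `<=` d2 ->
  pa_mul x y = \sum_(p <- d1) \sum_(q <- d2) (x@_p * y@_q) *: path_mul p q.
Proof.
move=> le_d1 le_d2; rewrite /pa_mul (big_fset_incl _ le_d1) /=.
  apply/eq_bigr=> k1 _; apply/big_fset_incl => // k _ /mcoeff_outdom ->.
  by rewrite mulr0 scale0r.
move=> k _ /mcoeff_outdom xk.
by rewrite big1 => // k' _; rewrite xk mul0r scale0r.
Qed.

Lemma pa_mulDl : left_distributive pa_mul +%R.
Proof.
move=> x y z.
rewrite (pa_mulw (msuppD_le x y) (fsubset_refl _)).
rewrite (pa_mulw (fsubsetUl _ (msupp y)) (fsubset_refl (msupp z))).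
rewrite (pa_mulw (fsubsetUr (msupp x) _) (fsubset_refl (msupp z))).
rewrite -big_split /=; apply/eq_bigr=> p _.
rewrite -big_split /=; apply/eq_bigr=> q _.
by rewrite mcoeffD mulrDl scalerDl.
Qed.

Lemma pa_mulDr : right_distributive pa_mul +%R.
Proof.
move=> z x y.
rewrite (pa_mulw (fsubset_refl _) (msuppD_le x y)).
rewrite (pa_mulw (fsubset_refl (msupp z)) (fsubsetUl _ (msupp y))).
rewrite (pa_mulw (fsubset_refl (msupp z)) (fsubsetUr (msupp x) _)).
rewrite -big_split /=; apply/eq_bigr=> p _.
rewrite -big_split /=; apply/eq_bigr=> q _.
by rewrite mcoeffD mulrDr scalerDl.
Qed.

Lemma pa_mul0l x : pa_mul 0 x = 0.
Proof. by rewrite /pa_mul msupp0 big_seq_fset0. Qed.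

Lemma pa_mul0r x : pa_mul x 0 = 0.
Proof. by rewrite /pa_mul big1 // => p _; rewrite msupp0 big_seq_fset0. Qed.

Lemma pa_mulZl c x y : pa_mul (c *: x) y = c *: pa_mul x y.
Proof.
rewrite (pa_mulw (msuppZ_le c x) (fsubset_refl _)) scaler_sumr.
apply/eq_bigr=> p _; rewrite scaler_sumr; apply/eq_bigr=> q _.
by rewrite mcoeffZ scalerA mulrA.
Qed.

Lemma pa_mulZr c x y : pa_mul x (c *: y) = c *: pa_mul x y.
Proof.
rewrite (pa_mulw (fsubset_refl _) (msuppZ_le c y)) scaler_sumr.
apply/eq_bigr=> p _; rewrite scaler_sumr; apply/eq_bigr=> q _.
by rewrite mcoeffZ scalerA mulrCA.
Qed.

Lemma pa_mulpp p q : pa_mul (path_elt p) (path_elt q) = path_mul p q.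
Proof.
rewrite (pa_mulw (msuppU_le (k := p)) (msuppU_le (k := q))).
by rewrite !big_seq_fset1 !mcoeffUU mulr1 scale1r.
Qed.

Lemma pa_ind (P : path_algebra -> Prop) :
  P 0 -> (forall x y, P x -> P y -> P (x + y)) ->
  (forall c p, P (c *: path_elt p)) -> forall x, P x.
Proof.
move=> P0 PD PZ x; rewrite [x]monalgE.
apply: (big_ind P) => // p _; rewrite (_ : << _ *g _ >> = x@_p *: path_elt p) //.
by apply/malgP=> q; rewrite mcoeffZ !mcoeffU mulr_natr.
Qed.

Lemma pa_mulA_path p q r :
  pa_mul (path_elt p) (pa_mul (path_elt q) (path_elt r)) =
  pa_mul (pa_mul (path_elt p) (path_elt q)) (path_elt r).
Proof.
rewrite !pa_mulpp /path_mul; have := pcatA p q r.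
case: (pcat p q) => [s|]; case: (pcat q r) => [t|] //=;
  rewrite ?pa_mulpp /path_mul ?pa_mul0l ?pa_mul0r //.
- by move=> ->.
- by move=> ->.
- by move=> <-.
Qed.

Lemma pa_mulA : associative pa_mul.
Proof.
move=> x y z; elim/pa_ind: x => [|x x' IHx IHx'|a p].
- by rewrite !pa_mul0l.
- by rewrite !pa_mulDl IHx IHx'.
rewrite !pa_mulZl; congr (_ *: _); elim/pa_ind: y => [|y y' IHy IHy'|b q].
- by rewrite !(pa_mul0l, pa_mul0r).
- by rewrite pa_mulDl !pa_mulDr pa_mulDl IHy IHy'.
rewrite pa_mulZl !pa_mulZr pa_mulZl; congr (_ *: _).
elim/pa_ind: z => [|z z' IHz IHz'|c r].
- by rewrite !pa_mul0r.
- by rewrite !pa_mulDr IHz IHz'.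
by rewrite !pa_mulZr pa_mulA_path.
Qed.

Lemma pa_mul1_path p : pa_mul pa_one (path_elt p) = path_elt p.
Proof.
rewrite /pa_one (big_morph (pa_mul^~ _) (fun _ _ => pa_mulDl _ _ _) (pa_mul0l _)).
rewrite (bigD1 (pstart p)) //= big1 ?addr0 => [|v /negPf nv];
  rewrite pa_mulpp /path_mul; case: pcatP => //.
- by move=> r _ h1 _ h2; congr path_elt; apply: qpath_eq.
- by rewrite eqxx.
- by move=> r e; rewrite -e eqxx in nv.
Qed.

Lemma pa_mulp1_path p : pa_mul (path_elt p) pa_one = path_elt p.
Proof.
rewrite /pa_one (big_morph (pa_mul _) (fun _ _ => pa_mulDr _ _ _) (pa_mul0r _)).
rewrite (bigD1 (pend p)) //= big1 ?addr0 => [|v /negPf nv];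
  rewrite pa_mulpp /path_mul; case: pcatP => //.
- by move=> r _ h1 _ h2; congr path_elt; apply: qpath_eq; rewrite // h2 cats0.
- by rewrite eqxx.
- by move=> r e; rewrite e eqxx in nv.
Qed.

Lemma pa_mul1l : left_id pa_one pa_mul.
Proof.
move=> x; elim/pa_ind: x => [|x y IHx IHy|c p]; first exact: pa_mul0r.
- by rewrite pa_mulDr IHx IHy.
by rewrite pa_mulZr pa_mul1_path.
Qed.

Lemma pa_mul1r : right_id pa_one pa_mul.
Proof.
move=> x; elim/pa_ind: x => [|x y IHx IHy|c p]; first exact: pa_mul0l.
- by rewrite pa_mulDl IHx IHy.
by rewrite pa_mulZl pa_mulp1_path.
Qed.

HB.instance Definition _ := GRing.Zmodule_isPzRing.Build path_algebra
  pa_mulA pa_mul1l pa_mul1r pa_mulDl pa_mulDr.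

Definition arrow_elt (a : arrow Q) : path_algebra := path_elt (arrow_path a).

Definition arrow_ideal : path_algebra -> Prop :=
  ideal_generated (fun x => exists a, x = arrow_elt a).

End PathAlgebra.

Section StringAlgebra.
Variables (K : fieldType) (Q : quiver) (I : twoSidedIdeal (path_algebra Q K)).

Definition admissible : Prop :=
  (exists m : nat, (2 <= m)%N /\
     forall x, ideal_power (@arrow_ideal Q K) m x -> x \in I) /\
  (forall x, x \in I -> ideal_power (@arrow_ideal Q K) 2 x).

Definition generated_by_paths : Prop :=
  exists P : qpath Q -> Prop, forall x,
    x \in I <-> ideal_generated (fun y => exists2 p, P p & y = path_elt K p) x.

(* In the last two clauses a product of non-composable arrows is 0, hence
   in I. *)
Definition string_algebra : Prop :=
  [/\ admissible,
      generated_by_paths,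
      forall v : vertex Q,
        (#|[set a : arrow Q | target a == v]| <= 2)%N /\
        (#|[set a : arrow Q | source a == v]| <= 2)%N,
      forall a b b' : arrow Q,
        arrow_elt K a * arrow_elt K b \notin I ->
        arrow_elt K a * arrow_elt K b' \notin I -> b = b'
    & forall a c c' : arrow Q,
        arrow_elt K c * arrow_elt K a \notin I ->
        arrow_elt K c' * arrow_elt K a \notin I -> c = c'].

End StringAlgebra.

Definition degree (Q : quiver) (v : vertex Q) : nat :=
  (#|[set a : arrow Q | source a == v]| +
   #|[set a : arrow Q | target a == v]|)%N.

Definition finitely_generated (L : pzRingType) (M : lmodType L) : Prop :=
  exists (n : nat) (g : 'I_n -> M),
    forall x : M, exists c : 'I_n -> L, x = \sum_(i < n) c i *: g i.

(* As usual the empty class is excluded: torsion classes contain 0.  Closure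
   under isomorphism is a case of closure under quotients. *)
Record torsion_class (L : pzRingType) := TorsionClass {
  tors_mem :> lmodType L -> Prop;
  tors_fg : forall M, tors_mem M -> finitely_generated M;
  tors_zero : forall M : lmodType L, (forall x : M, x = 0) -> tors_mem M;
  tors_quotient : forall (M N : lmodType L) (f : {linear M -> N}),
    (forall y, exists x, f x = y) -> tors_mem M -> tors_mem N;
  tors_extension : forall (M' M M'' : lmodType L)
      (f : {linear M' -> M}) (g : {linear M -> M''}),
    injective f -> (forall z, exists y, g y = z) ->
    (forall y, g y = 0 <-> exists x, f x = y) ->
    tors_mem M' -> tors_mem M'' -> tors_mem M
}.

Section Tors.
Variable (L : pzRingType).
Implicit Types (X Y : torsion_class L) (C D : torsion_class L -> Prop).

Definition tors_le X Y : Prop := forall M, X M -> Y M.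

Definition tors_chain C : Prop :=
  forall X Y, C X -> C Y -> tors_le X Y \/ tors_le Y X.

Definition tors_maximal_chain C : Prop :=
  tors_chain C /\
  forall D, tors_chain D -> (forall X, C X -> D X) -> forall X, D X -> C X.

Definition maximal_green_sequence (n : nat) (T : 'I_n -> torsion_class L) : Prop :=
  (forall i j : 'I_n, (i < j)%N -> tors_le (T i) (T j) /\ ~ tors_le (T j) (T i)) /\
  tors_maximal_chain (fun X => exists i, X = T i).

Definition has_maximal_green_sequence : Prop :=
  exists (n : nat) (T : 'I_n -> torsion_class L), maximal_green_sequence T.

End Tors.

(* Main.v *)
Require Import Defs.
From HB Require Import structures.
From mathcomp Require Import all_boot all_order all_algebra.
From mathcomp Require Import generic_quotient ring_quotient boolp.

(** A maximal chain of torsion classes is built by removing the vertices of the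
    quiver one at a time.  Modules are left modules, so a path read from left
    to right acts through its last arrow first, and [e v x = x] is moved by the
    paths that end at [v].

    For a set [W] of vertices let T(W) be the class of modules all of whose
    nonzero quotients are nonzero at some vertex outside [W].  These are the
    modules with top outside [W]; T(all vertices) = 0 and T(empty) contains
    every module.  It is enough to fill the gap between T(W) and T(W minus v),
    for a well chosen [v] in [W], by finitely many torsion classes each of
    which covers or equals the preceding one.

    A vertex of degree at most three has at most one incoming or at most one
    outgoing arrow.  Counting the arrows inside [W] by sources and by targets
    shows that not every vertex of [W] can receive two of them, so some [v] in
    [W] receives at most one arrow from [W] ([vertex_with_few_incoming]).  By
    the string conditions a path inside [W] that ends at [v] and is nonzero is
    then determined by its length ([word_uniq]): the projective cover of the
    simple module at [v], over the algebra supported on [W], is uniserial.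

    Between T(W) and T(W minus v) put the classes T_r generated by T(W) and
    the quotients of length at most r of this uniserial module: every nonzero
    quotient has a nonzero element which either lives outside [W], or lives at
    [v] and is killed by all paths of length r.  Let Y be a torsion class
    between T_r and T_(r+1) and not contained in T_r.  It contains a nonzero N
    with no nonzero element marked by T_r, and N contains an x marked by
    T_(r+1), which generates the uniserial module C of length r+1.  The crucial
    fact is that N/C has again no marked element ([mark_free_quotient]).  Such
    an element would lift to a y not in C that the path p of length r sends
    into C but not to 0.  In N the elements [p y] and [q x], for some proper
    suffix q of p, would then both survive under a common arrow, whence the
    string conditions force q to be an initial segment of p as well; so p
    passes through [v] again, which yields a nonzero element of C at [v]
    killed by all paths of length r, a contradiction ([no_common_predecessor]).
    Dividing out copies of C thus never stops before the quotient is C itself,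
    so C is in Y and T_(r+1) is contained in Y ([mark_class_cover]). *)

Set Implicit Arguments.
Unset Strict Implicit.
Unset Printing Implicit Defensive.

Import GRing.Theory.
Local Open Scope ring_scope.

(** * Submodules, quotients and cyclic modules *)

Section LinearMap.
Context (L : pzRingType) (M N : lmodType L) (k : M -> N).
Hypothesis k_linear : linear k.
HB.instance Definition _ := GRing.isLinear.Build L M N _ k k_linear.

(** Packs a map chosen classically, which has no canonical linear structure. *)
Lemma linear_map_exists : exists f : {linear M -> N}, forall x, f x = k x.
Proof. by exists (k : {linear M -> N}). Qed.
End LinearMap.

Section SubmoduleQuotient.
Context (L : pzRingType) (M : lmodType L) (A : M -> Prop).
Hypothesis A0 : A 0.
Hypothesis AL : forall a x y, A x -> A y -> A (a *: x + y).

Let inA : {pred M} := fun x => `[<A x>].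

Let inA_closed : submod_closed inA.
Proof.
split; first exact/asboolP.
by move=> a x y /asboolP Ax /asboolP Ay; apply/asboolP/AL.
Qed.

HB.instance Definition _ := GRing.isSubmodClosed.Build L M inA inA_closed.

Record submodule := Submodule { submodule_val : M; _ : submodule_val \in inA }.
HB.instance Definition _ := [isSub for submodule_val].
HB.instance Definition _ := [Choice of submodule by <:].
HB.instance Definition _ := [SubChoice_isSubLmodule of submodule by <:].

Lemma submodule_exists :
  exists (N : lmodType L) (f : {linear N -> M}),
    injective f /\ forall x, A x <-> exists y, f y = x.
Proof.
exists submodule, (val : {linear submodule -> M}); split; first exact: val_inj.
move=> x; split=> [Ax|[y <-]]; last by have /asboolP := valP y.
by have Ax' : x \in inA by [apply/asboolP]; exists (Submodule Ax').
Qed.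

Definition quotient_module : Type := Quotient.quot inA.
HB.instance Definition _ := GRing.Zmodule.on quotient_module.
HB.instance Definition _ := ZmodQuotient.on quotient_module.
Local Open Scope quotient_scope.

Let qscale (a : L) (x : quotient_module) : quotient_module :=
  \pi_quotient_module (a *: repr x).

Let qpi (x y : M) :
  (\pi_quotient_module x = \pi_quotient_module y) <-> A (x - y).
Proof.
have e : (\pi_quotient_module x == \pi_quotient_module y) = (x - y \in inA).
  by rewrite Quotient.idealrBE.
by split=> [/eqP|/asboolP h]; [rewrite e => /asboolP | apply/eqP; rewrite e].
Qed.

Let piD x y :
  \pi_quotient_module x + \pi_quotient_module y = \pi_quotient_module (x + y).
Proof. by rewrite [RHS]Quotient.pi_add. Qed.

Let qscaleE a x : qscale a (\pi x) = \pi_quotient_module (a *: x).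
Proof.
apply/qpi; rewrite -scalerBr -[_ *: _]addr0; apply: AL => //.
by apply/qpi; rewrite reprK.
Qed.

Let qscaleA a b x : qscale a (qscale b x) = qscale (a * b) x.
Proof. by elim/quotW: x => x; rewrite !qscaleE scalerA. Qed.
Let qscale1 : left_id 1 qscale.
Proof. by elim/quotW => x; rewrite !qscaleE scale1r. Qed.
Let qscaleDr : right_distributive qscale +%R.
Proof.
move=> a; elim/quotW => x; elim/quotW => y.
by rewrite piD !qscaleE piD scalerDr.
Qed.
Let qscaleDl x : {morph qscale^~ x : a b / a + b}.
Proof. by move=> a b; elim/quotW: x => x; rewrite !qscaleE piD scalerDl. Qed.

HB.instance Definition _ := GRing.Zmodule_isLmodule.Build L quotient_module
  qscaleA qscale1 qscaleDr qscaleDl.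

Definition quotient_map (x : M) : quotient_module := \pi x.

Let quotient_map_linear : linear quotient_map.
Proof. by move=> a x y; rewrite /quotient_map -piD -qscaleE. Qed.

HB.instance Definition _ := GRing.isLinear.Build L M quotient_module _
  quotient_map quotient_map_linear.

Lemma quotient_exists :
  exists (N : lmodType L) (f : {linear M -> N}),
    (forall y, exists x, f x = y) /\ forall x, f x = 0 <-> A x.
Proof.
exists quotient_module, (quotient_map : {linear M -> quotient_module}); split.
  by elim/quotW => x; exists x.
by move=> x; rewrite -{2}(subr0 x) -qpi -/(quotient_map 0) raddf0.
Qed.

End SubmoduleQuotient.

Lemma factor_exists (L : pzRingType) (M N P : lmodType L)
    (g : {linear M -> N}) (h : {linear M -> P}) :
  (forall y, exists x, g x = y) -> (forall x, g x = 0 -> h x = 0) ->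
  exists k : {linear N -> P}, forall x, k (g x) = h x.
Proof.
move=> g_surj ker_sub; pose s y := projT1 (cid (g_surj y)).
have gs y : g (s y) = y by exact: projT2 (cid (g_surj y)).
have hsg x : h (s (g x)) = h x.
  by apply/eqP; rewrite -subr_eq0 -linearB ker_sub // linearB gs subrr.
have k_linear : linear (fun y => h (s y)).
  by move=> a x y; rewrite -{1}(gs x) -{1}(gs y) -linearP hsg linearP.
by have [k kE] := linear_map_exists k_linear; exists k => x; rewrite kE hsg.
Qed.

Section CyclicModules.
Context (L : pzRingType).
Implicit Types M N A : lmodType L.

Definition generates M (x : M) := forall y, exists l : L, y = l *: x.

Lemma cyclic_submodule_exists N (x : N) :
  exists A (i : {linear A -> N}) (xi : A),
    [/\ injective i, i xi = x & generates xi].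
Proof.
have [|a y z [b ->] [c ->]|A [i [inj im]]] :=
    @submodule_exists L N (fun y => exists l, y = l *: x).
- by exists 0; rewrite scale0r.
- by exists (a * b + c); rewrite scalerDl scalerA.
have [xi ixi] : exists xi, i xi = x by apply/im; exists 1; rewrite scale1r.
exists A, i, xi; split=> // y.
have [l yl] : exists l, i y = l *: x by apply/im; exists y.
by exists l; apply: inj; rewrite yl linearZ ixi.
Qed.

Lemma cyclic_map_exists M N (x : M) (z : N) :
  generates x -> (forall l : L, l *: x = 0 -> l *: z = 0) ->
  exists f : {linear M -> N}, forall l, f (l *: x) = l *: z.
Proof.
move=> genx ann_sub; pose coef y := projT1 (cid (genx y)).
have coefK y : y = coef y *: x by exact: projT2 (cid (genx y)).
have kE l : coef (l *: x) *: z = l *: z.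
  apply/eqP; rewrite -subr_eq0 -scalerBl; apply/eqP/ann_sub.
  by rewrite scalerBl -coefK subrr.
have k_linear : linear (fun y => coef y *: z).
  move=> a y y'; rewrite {1}(coefK y) {1}(coefK y') scalerA -scalerDl kE.
  by rewrite scalerDl -scalerA.
by have [k kk] := linear_map_exists k_linear; exists k => l; rewrite kk kE.
Qed.

Lemma fg_cyclic M (x : M) : generates x -> finitely_generated M.
Proof.
move=> gx; exists 1, (fun _ => x) => y; have [l ->] := gx y.
by exists (fun _ => l); rewrite big_ord1.
Qed.

Lemma fg_quotient M N (f : {linear M -> N}) :
  (forall y, exists x, f x = y) -> finitely_generated M -> finitely_generated N.
Proof.
move=> fs [n [g gen]]; exists n, (f \o g) => y; have [x <-] := fs y.
have [c ->] := gen x; exists c; rewrite linear_sum.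
by apply: eq_bigr => i _; rewrite linearZ.
Qed.

Lemma fg_extension (M' M M'' : lmodType L)
    (f : {linear M' -> M}) (g : {linear M -> M''}) :
  (forall z, exists y, g y = z) ->
  (forall y, g y = 0 -> exists x, f x = y) ->
  finitely_generated M' -> finitely_generated M'' -> finitely_generated M.
Proof.
move=> gs ex [n1 [g1 gen1]] [n2 [g2 gen2]].
pose lft y := projT1 (cid (gs y)).
have lftK y : g (lft y) = y by exact: projT2 (cid (gs y)).
exists (n1 + n2)%N.
exists (fun i =>
  match split i with inl j => f (g1 j) | inr j => lft (g2 j) end).
move=> y; have [c2 yc2] := gen2 (g y).
have [x fx] : exists x, f x = y - \sum_(j < n2) c2 j *: lft (g2 j).
  apply: ex; rewrite linearB linear_sum yc2; apply/eqP; rewrite subr_eq0.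
  by apply/eqP/eq_bigr => j _; rewrite linearZ lftK.
have [c1 xc1] := gen1 x.
exists (fun i => match split i with inl j => c1 j | inr j => c2 j end).
rewrite big_split_ord /=.
under eq_bigr => j _ do rewrite (unsplitK (inl j : 'I_n1 + 'I_n2)).
under [X in _ + X]eq_bigr => j _ do rewrite (unsplitK (inr j : 'I_n1 + 'I_n2)).
have -> : \sum_(j < n1) c1 j *: f (g1 j) = f x.
  by rewrite xc1 linear_sum; apply: eq_bigr => j _; rewrite linearZ.
by rewrite fx subrK.
Qed.

End CyclicModules.

(** * Torsion classes given by marked elements *)

Section TorsionGenerated.
Context (L : pzRingType).

Lemma tors_le_antisym (X Y : torsion_class L) :
  tors_le X Y -> tors_le Y X -> X = Y.
Proof.
case: X => X X1 X2 X3 X4; case: Y => Y Y1 Y2 Y3 Y4; rewrite /tors_le /= => xy yx.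
have e : X = Y.
  by apply/funext => M; apply/propext; split; [apply: xy|apply: yx].
case: Y / e Y1 Y2 Y3 Y4 xy yx => *; congr TorsionClass; exact: Prop_irrelevance.
Qed.

Context (G : forall N : lmodType L, N -> Prop).
Hypothesis G_hom : forall (M N : lmodType L) (f : {linear M -> N}) x,
  G x -> G (f x).

Definition has_marked (N : lmodType L) :=
  (exists y : N, y <> 0) -> exists x : N, x <> 0 /\ G x.

(** For modules of finite length this is the torsion class generated by the
    cyclic modules on marked elements: in a module outside a torsion class, the
    quotient by the largest submodule that belongs to the class is nonzero and
    has no nonzero submodule in the class. *)
Definition marked_class (M : lmodType L) :=
  finitely_generated M /\
  forall (N : lmodType L) (f : {linear M -> N}),
    (forall y, exists x, f x = y) -> has_marked N.

Let marked_zero (M : lmodType L) : (forall x : M, x = 0) -> marked_class M.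
Proof.
move=> M0; split.
  by exists 0, (fun _ => 0) => x; exists (fun _ => 0); rewrite big_ord0 (M0 x).
move=> N f fs [y]; have [x <-] := fs y; by rewrite (M0 x) linear0.
Qed.

Let marked_quotient (M N : lmodType L) (f : {linear M -> N}) :
  (forall y, exists x, f x = y) -> marked_class M -> marked_class N.
Proof.
move=> fs [fg mk]; split; first exact: fg_quotient fg.
move=> P g gs; apply: (mk P (g \o f)) => z.
by have [y <-] := gs z; have [x <-] := fs y; exists x.
Qed.

Let marked_extension (M' M M'' : lmodType L)
    (f : {linear M' -> M}) (g : {linear M -> M''}) :
  injective f -> (forall z, exists y, g y = z) ->
  (forall y, g y = 0 <-> exists x, f x = y) ->
  marked_class M' -> marked_class M'' -> marked_class M.
Proof.
move=> _ gs ex [fg' mk'] [fg'' mk'']; split.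
  by apply: (@fg_extension L M' M M'' f g gs) => // y /ex.
move=> N h hs Nn0.
(* A quotient N of M either kills M', hence is a quotient of M'', or contains
   a nonzero quotient of M', namely the image A of M'. *)
have [k0|] := pselect (forall x, h (f x) = 0).
  have [|k kE] := @factor_exists L M M'' N g h gs.
    by move=> x /ex [y <-].
  by apply: (mk'' N k) => // y; have [x <-] := hs y; exists (g x).
move/existsNP => [x0 hx0].
have [|a y z [b <-] [c <-]|A [i [inj im]]] :=
    @submodule_exists L N (fun y => exists x, h (f x) = y).
- by exists 0; rewrite !linear0.
- by exists (a *: b + c); rewrite !linearP.
have key x : exists y, i y = h (f x) by apply/im; exists x.
have iK x : i (projT1 (cid (key x))) = h (f x) by exact: projT2 (cid (key x)).
pose k x := projT1 (cid (key x)).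
have k_lin : linear k by move=> a x y; apply: inj; rewrite linearP !iK !linearP.
have [kL kLE] := linear_map_exists k_lin.
have [y||x [xn0 Gx]] := mk' A kL.
- have /im [x hx] : exists z, i z = i y by exists y.
  by exists x; apply: inj; rewrite kLE iK hx.
- by exists (kL x0) => e; apply: hx0; rewrite -iK -/(k x0) -kLE e linear0.
exists (i x); split; last exact: G_hom.
by move=> e; apply: xn0; apply: inj; rewrite e linear0.
Qed.

Definition marked_torsion_class : torsion_class L :=
  @TorsionClass L marked_class (fun M => @proj1 _ _) marked_zero
    marked_quotient marked_extension.

End TorsionGenerated.

(** * Finite chains of covers are maximal chains *)

Section Chains.
Context (L : pzRingType).
Implicit Types X Y Z : torsion_class L.

Lemma tors_le_trans Y X Z : tors_le X Y -> tors_le Y Z -> tors_le X Z.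
Proof. by move=> xy yz M /xy /yz. Qed.

Definition no_class_between X Y :=
  forall Z, tors_le X Z -> tors_le Z Y -> tors_le Z X \/ tors_le Y Z.

(** [no_class_between X Y] holds also when [X] and [Y] coincide, so the steps
    of such a chain need not be strict. *)
Inductive cover_chain (Y : torsion_class L) : torsion_class L -> Prop :=
| CoverChainNil : cover_chain Y Y
| CoverChainStep X Z of tors_le X Z & no_class_between X Z & cover_chain Y Z :
    cover_chain Y X.

(** Deleting the repetitions of a chain of weak covers leaves a strictly
    increasing family which no comparable class can refine. *)
Lemma cover_chain_saturated X Y : cover_chain Y X ->
  exists (n : nat) (T : 'I_n.+1 -> torsion_class L),
  [/\ T ord0 = X,
      forall i j : 'I_n.+1, (i < j)%N ->
        tors_le (T i) (T j) /\ ~ tors_le (T j) (T i)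
    & forall Z, tors_le X Z -> tors_le Z Y ->
        (forall i, tors_le Z (T i) \/ tors_le (T i) Z) -> exists i, Z = T i].
Proof.
elim=> [|{}X Z XZ XZcov _ [n [T [T0 Tinc Tsat]]]].
  exists 0%N, (fun _ => Y); split=> // [i j|Z YZ ZY _].
    by rewrite !ord1.
  by exists ord0; exact: tors_le_antisym.
have ZT i : tors_le Z (T i).
  rewrite -T0; case: (posnP i) => [i0|/(Tinc ord0)[]//].
  by have -> : i = ord0 by [apply: val_inj].
(* A repetition: the family obtained from Z onwards already starts at X. *)
have [ZX|nZX] := pselect (tors_le Z X).
  have -> : X = Z by exact: tors_le_antisym.
  by exists n, T.
exists n.+1, (fun i => if unlift ord0 i is Some j then T j else X).
split; first by rewrite unlift_none.
- move=> i j; case: (unliftP ord0 i) => [i'|] ->;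
    case: (unliftP ord0 j) => [j'|] -> //=.
    by rewrite /bump !leq0n !add1n ltnS => /Tinc.
  move=> _; split; first exact: tors_le_trans XZ (ZT _).
  by move=> TX; apply: nZX; apply: tors_le_trans (ZT _) TX.
move=> V XV VY comp.
have compT i : tors_le V (T i) \/ tors_le (T i) V.
  by have := comp (lift ord0 i); rewrite liftK.
have ZV_done : tors_le Z V ->
    exists i, V = if unlift ord0 i is Some j then T j else X.
  move=> ZV; have [i ->] := Tsat V ZV VY compT.
  by exists (lift ord0 i); rewrite liftK.
case: (compT ord0); rewrite T0 //; move=> VZ.
have [VX|] := XZcov V XV VZ; last exact: ZV_done.
by exists ord0; rewrite unlift_none; exact: tors_le_antisym.
Qed.

Lemma cover_chain_has_mgs X Y :
  (forall Z, tors_le X Z) -> (forall Z, tors_le Z Y) -> cover_chain Y X ->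
  has_maximal_green_sequence L.
Proof.
move=> Xmin Ymax /cover_chain_saturated [n [T [_ Tinc Tsat]]].
exists n.+1, T; split=> //; split.
  move=> _ _ [i ->] [j ->]; case: (ltngtP i j) => [/Tinc[]|/Tinc[]|/val_inj ->];
    by [left|right|left].
move=> D Dchain CD X' DX'; apply: Tsat => // i.
by apply: Dchain => //; apply: CD; exists i.
Qed.

End Chains.

(** * Finite spans over the ground field *)

Section Span.
Context (K : fieldType) (L : pzRingType) (kappa : {rmorphism K -> L}).
Implicit Types M N : lmodType L.

(** Modules over [L] become vector spaces through [kappa].  The recursion on
    the list serves the exchange argument below. *)
Fixpoint kspan M (s : seq M) (x : M) : Prop :=
  if s is b :: s' then exists c : K, kspan s' (x - kappa c *: b) else x = 0.

Lemma kspan0 M (s : seq M) : kspan s 0.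
Proof.
by elim: s => //= b s IH; exists 0; rewrite rmorph0 scale0r subr0.
Qed.

Lemma kspan_comb M (s : seq M) c x y :
  kspan s x -> kspan s y -> kspan s (kappa c *: x + y).
Proof.
elim: s x y => [|b s IH] x y /=; first by move=> -> ->; rewrite scaler0 addr0.
move=> [d xd] [e ye]; exists (c * d + e).
have -> : kappa c *: x + y - kappa (c * d + e) *: b =
  kappa c *: (x - kappa d *: b) + (y - kappa e *: b).
  by rewrite rmorphD rmorphM scalerDl scalerBr scalerA opprD addrACA.
exact: IH.
Qed.

Lemma kspanD M (s : seq M) x y : kspan s x -> kspan s y -> kspan s (x + y).
Proof. by move=> /(kspan_comb 1) h /h; rewrite rmorph1 scale1r. Qed.

Lemma kspanZ M (s : seq M) c x : kspan s x -> kspan s (kappa c *: x).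
Proof. by move=> h; rewrite -[_ *: _]addr0; apply: kspan_comb h (kspan0 _). Qed.

Lemma kspan_cons M (s : seq M) b x : kspan s x -> kspan (b :: s) x.
Proof. by exists 0; rewrite rmorph0 scale0r subr0. Qed.

Lemma kspan_mem M (s : seq M) x : x \in s -> kspan s x.
Proof.
elim: s => //= b s IH; rewrite inE => /orP [/eqP ->|/IH]; last exact: kspan_cons.
by exists 1; rewrite rmorph1 scale1r subrr; exact: kspan0.
Qed.

Lemma kspan_cat M (s t : seq M) x y :
  kspan s x -> kspan t y -> kspan (s ++ t) (x + y).
Proof.
elim: s x => [|b s IH] x /=; first by move=> ->; rewrite add0r.
by move=> [c xc] yt; exists c; rewrite addrAC; exact: IH.
Qed.

Lemma kspan_map M N (f : {linear M -> N}) s x :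
  kspan s x -> kspan (map f s) (f x).
Proof.
elim: s x => [|b s IH] x /=; first by move=> ->; rewrite linear0.
by move=> [c /IH]; rewrite linearB linearZ; exists c.
Qed.

(** A nonzero vector of the span can replace one of the spanning vectors, so
    that modulo this vector a shorter list suffices.  This gives the inductions
    on dimension without a notion of dimension. *)
Lemma kspan_exchange M (s : seq M) x : kspan s x -> x <> 0 ->
  exists2 s', (size s' < size s)%N &
  forall y, kspan s y -> exists c, kspan s' (y - kappa c *: x).
Proof.
elim: s x => [|b s IH] x //= [c xc] xn0.
have [c0|cn0] := eqVneq c 0.
  move: xc; rewrite c0 rmorph0 scale0r subr0 => xs.
  have [s' lt ex] := IH _ xs xn0; exists (b :: s') => //= y [d /ex [e ye]].
  by exists e, d; rewrite addrAC.
exists s => // y [d yd]; exists (d / c).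
have -> : y - kappa (d / c) *: x =
    kappa (- (d / c)) *: (x - kappa c *: b) + (y - kappa d *: b).
  rewrite scalerBr scalerA -rmorphM mulNr divfK // !rmorphN !scaleNr.
  by rewrite opprK addrACA subrr addr0 addrC.
exact: kspan_comb.
Qed.

Definition spanned M (d : nat) :=
  exists2 s : seq M, (size s <= d)%N & forall x, kspan s x.

Lemma spanned_quotient M N (f : {linear M -> N}) d x :
  (forall y, exists x, f x = y) -> spanned M d.+1 -> x <> 0 -> f x = 0 ->
  spanned N d.
Proof.
move=> fs [s sd sM] xn0 fx0; have [s' lt ex] := kspan_exchange (sM x) xn0.
exists (map f s'); first by rewrite size_map -ltnS (leq_trans lt).
move=> y; have [z <-] := fs y; have [c /(kspan_map f)] := ex z (sM z).
by rewrite linearB linearZ /= fx0 scaler0 subr0.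
Qed.

Lemma spanned0 M : spanned M 0 -> forall x : M, x = 0.
Proof. by case=> -[|//] _ h x; exact: (h x). Qed.

Lemma spanned_fg (B : seq L) :
  (forall M (x : M) a, kspan [seq b *: x | b <- B] (a *: x)) ->
  forall M, finitely_generated M -> exists d, spanned M d.
Proof.
move=> spB M [n [g gen]].
pose s := flatten [seq [seq b *: g i | b <- B] | i <- index_enum 'I_n].
exists (size s), s => // x; have [c ->] := gen x; rewrite /s.
elim: (index_enum _) => [|i l IH]; first by rewrite big_nil.
by rewrite big_cons /=; apply: kspan_cat.
Qed.

(** Submodules that belong to [Y] are split off one after the other until
    nothing is left; closure under extensions puts them together again. *)
Lemma tors_mem_filtered (Y : torsion_class L) d M :
  spanned M d ->
  (forall N (f : {linear M -> N}), (forall y, exists x, f x = y) ->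
    (exists y : N, y <> 0) ->
    exists (A : lmodType L) (i : {linear A -> N}),
      [/\ injective i, exists a : A, a <> 0 & Y A]) ->
  Y M.
Proof.
elim: d M => [|d IH] M sM filt; first by apply: tors_zero; exact: spanned0.
have [M0|/existsNP Mn0] := pselect (forall x : M, x = 0); first exact: tors_zero.
have [|A [i [inj [a an0] YA]]] := filt M idfun _ Mn0; first by move=> y; exists y.
have [|b x y [u <-] [v <-]|N [f [fs ker]]] :=
    @quotient_exists L M (fun x => exists a, i a = x).
- by exists 0; rewrite linear0.
- by exists (b *: u + v); rewrite linearP.
apply: (tors_extension inj fs ker YA); apply: IH.
  apply: (@spanned_quotient M N f d (i a)) => //.
    by move=> e; apply: an0; apply: inj; rewrite e linear0.
  by apply/ker; exists a.
move=> P g gs Pn0; apply: (filt P (g \o f)) => // y.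
by have [z <-] := gs y; have [x <-] := fs z; exists x.
Qed.

End Span.

(** * Choosing the vertex to remove *)

(** Otherwise every vertex of [W] receives two arrows from [W] and so, its
    degree being at most three, emits at most one arrow: there would be more
    arrows inside [W] than arrows starting in [W]. *)
Lemma vertex_with_few_incoming (Q : quiver) (W : {set vertex Q}) :
  (forall v : vertex Q, (degree v <= 3)%N) -> W != set0 ->
  exists2 v, v \in W & forall a b : arrow Q, target a = v -> target b = v ->
    source a \in W -> source b \in W -> a = b.
Proof.
move=> deg3 Wn0.
pose inW v := [set a : arrow Q | (target a == v) && (source a \in W)].
have [v /andP[vW /card_le1_eqP in1]|in2] :=
    pickP (fun v => (v \in W) && (#|inW v| <= 1)%N).
  by exists v => // a b av bv aW bW; apply: in1; rewrite inE ?av ?bv ?eqxx.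
have in_big v : v \in W -> (1 < #|inW v|)%N.
  by move=> vW; have := in2 v; rewrite vW /= ltnNge => ->.
have out_small v : v \in W -> (#|[set a : arrow Q | source a == v]| <= 1)%N.
  move=> vW; have := deg3 v; rewrite /degree -ltnS => h.
  have : (#|inW v| <= #|[set a : arrow Q | target a == v]|)%N.
    by apply/subset_leq_card/subsetP => a; rewrite !inE => /andP[].
  move/(leq_trans (in_big v vW)) => h2.
  by rewrite -(leq_add2r 2) (leq_trans _ (deg3 v)) // /degree leq_add2l.
have card_fib (f : arrow Q -> vertex Q) (P : pred (arrow Q)) :
    (\sum_(v in W) #|[set a | (f a == v) && P a]| =
     #|[set a | (f a \in W) && P a]|)%N.
  rewrite -sum1dep_card (partition_big f [in W]) => [|a /andP[]//] /=.
  apply: eq_bigr => v vW; rewrite -sum1dep_card; apply: eq_bigl => a.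
  by case: eqP => [->|]; rewrite ?vW ?andbT ?andbF.
have lower : (#|W| * 2 <= \sum_(v in W) #|inW v|)%N.
  by rewrite -sum_nat_const; apply: leq_sum => v /in_big.
have upper : (\sum_(v in W) #|inW v| <= #|W|)%N.
  rewrite card_fib -[X in (_ <= X)%N]muln1 -sum_nat_const.
  apply: (@leq_trans
    (\sum_(v in W) #|[set a : arrow Q | (source a == v) && true]|)).
    rewrite (card_fib (@source Q) predT).
    by apply/subset_leq_card/subsetP => a; rewrite !inE andbT => /andP[].
  apply: leq_sum => v /out_small; congr (_ <= _)%N; apply: eq_card => a.
  by rewrite !inE andbT.
have := leq_trans lower upper; rewrite -[X in (_ <= X)%N]muln1.
by rewrite leq_pmul2l // card_gt0.
Qed.

(** * Uniserial projectives and the covers between vertex classes *)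

Section StringPresentation.
Context (K : fieldType) (L : pzRingType) (Q : quiver) (m : nat).
Context (kappa : {rmorphism K -> L}) (e : vertex Q -> L) (ar : arrow Q -> L).
Implicit Types (M N : lmodType L) (u v : vertex Q) (a b : arrow Q).
Implicit Types (p q w : seq (arrow Q)).

Definition word w : L := \prod_(a <- w) ar a.

(* The properties of a string algebra that the argument uses: [kappa], [e] and
   [ar] are the classes of the scalars, the trivial paths and the arrows. *)
Hypothesis kappaC : forall c l, kappa c * l = l * kappa c.
Hypothesis sum_e : \sum_v e v = 1.
Hypothesis e_mul : forall u v, e u * e v = if u == v then e u else 0.
Hypothesis e_source : forall a, e (source a) * ar a = ar a.
Hypothesis e_target : forall a, ar a * e (target a) = ar a.
Hypothesis word_nilp : forall w, (m <= size w)%N -> word w = 0.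
Hypothesis next_uniq : forall a b b',
  ar a * ar b <> 0 -> ar a * ar b' <> 0 -> b = b'.
Hypothesis prev_uniq : forall a c c',
  ar c * ar a <> 0 -> ar c' * ar a <> 0 -> c = c'.
Hypothesis L_ind : forall P : L -> Prop,
  P 0 -> (forall x y, P x -> P y -> P (x + y)) ->
  (forall c x, P x -> P (kappa c * x)) ->
  (forall u, P (e u)) -> (forall w, P (word w)) -> forall x, P x.

Lemma word_cons a w : word (a :: w) = ar a * word w.
Proof. by rewrite /word big_cons. Qed.

Lemma word_cat w w' : word (w ++ w') = word w * word w'.
Proof. by rewrite /word big_cat. Qed.

(** The trivial paths and the words shorter than the nilpotency bound [m] span
    the algebra. *)
Lemma finitely_spanned M : finitely_generated M -> exists d, spanned kappa M d.
Proof.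
pose words := flatten [seq [seq val t | t : n.-tuple (arrow Q)] | n <- iota 0 m].
apply: (@spanned_fg K L kappa ([seq e u | u <- enum (vertex Q)] ++ map word words)).
move=> {}M x l; elim/L_ind: l => [|l l' IH IH'|c l IH|u|w].
- by rewrite scale0r; exact: kspan0.
- by rewrite scalerDl; exact: kspanD.
- by rewrite -scalerA; exact: kspanZ.
- apply/kspan_mem/map_f; rewrite mem_cat; apply/orP; left.
  by apply/map_f; rewrite mem_enum.
have [/word_nilp ->|wm] := leqP m (size w); first by rewrite scale0r; exact: kspan0.
apply/kspan_mem/map_f; rewrite mem_cat; apply/orP; right; apply/map_f.
apply/flatten_mapP; exists (size w); first by rewrite mem_iota.
by apply/mapP; exists (in_tuple w); rewrite ?mem_enum.
Qed.

Section Step.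
Context (W : {set vertex Q}) (v : vertex Q).
Hypothesis v_in : forall a b, target a = v -> target b = v ->
  source a \in W -> source b \in W -> a = b.

Definition outside N (x : N) := exists2 u, u \notin W & e u *: x = x.
(** Cyclic modules on marked elements at [v] that vanish outside [W] are the
    quotients of length at most [r] of the uniserial projective at [v]. *)
Definition mark (r : nat) N (x : N) :=
  outside x \/ (e v *: x = x /\ forall w, size w = r -> word w *: x = 0).

Lemma outside_hom M N (f : {linear M -> N}) x : outside x -> outside (f x).
Proof. by move=> [u uW ux]; exists u; rewrite // -linearZ ux. Qed.

Lemma mark_hom r M N (f : {linear M -> N}) x : mark r x -> mark r (f x).
Proof.
move=> [/(outside_hom f)|[vx wx]]; [by left|right; split].
  by rewrite -linearZ vx.
by move=> w /wx; rewrite -linearZ => ->; rewrite linear0.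
Qed.

Lemma markS r N (x : N) : mark r x -> mark r.+1 x.
Proof.
case=> [|[vx wx]]; [by left|right; split] => // -[|a w] //= [sw].
by rewrite word_cons -scalerA wx // scaler0.
Qed.

Definition within N := forall u (x : N), u \notin W -> e u *: x = 0.

Lemma mark_free_within r N : (forall x : N, mark r x -> x = 0) -> within N.
Proof.
move=> free u x uW; apply: free; left; exists u => //.
by rewrite scalerA e_mul eqxx.
Qed.

Lemma ar_target N a u (x : N) : e u *: x = x -> ar a *: x <> 0 -> target a = u.
Proof.
move=> ux ax; apply/eqP/negPn/negP => /negPf n; apply: ax.
by rewrite -ux -e_target scalerA -mulrA e_mul n mulr0 scale0r.
Qed.

(** Reading both words from the right: the first arrow to act is the only one
    that goes from [W] to [v], and each later one is determined by the arrow
    that follows it in the word. *)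
Lemma word_uniq N N' (x : N) (x' : N') w w' :
  within N -> within N' -> e v *: x = x -> e v *: x' = x' ->
  size w = size w' -> word w *: x <> 0 -> word w' *: x' <> 0 -> w = w'.
Proof.
move=> inN inN' vx vx'; elim: w w' => [|a w IH] [|a' w'] //= [sww].
rewrite !word_cons -!scalerA => awx awx'.
have nz (P : lmodType L) (y : P) c t : ar c *: (word t *: y) <> 0 -> word t *: y <> 0.
  by move=> h h'; apply: h; rewrite h' scaler0.
have ww := IH w' sww (nz _ _ _ _ awx) (nz _ _ _ _ awx').
rewrite -{w' IH sww}ww in awx' *; congr (_ :: _).
have inW (P : lmodType L) (y : P) c : within P -> ar c *: y <> 0 -> source c \in W.
  move=> inP cy; apply/negPn/negP => n; apply: cy.
  by rewrite -e_source -scalerA inP.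
case: w awx awx' => [|b w] awx awx'.
  move: awx awx'; rewrite /word big_nil !scale1r => awx awx'.
  apply: v_in; [exact: ar_target vx awx|exact: ar_target vx' awx'| |].
    exact: inW inN awx.
  exact: inW inN' awx'.
have nz2 (P : lmodType L) (y : P) c :
    ar c *: (word (b :: w) *: y) <> 0 -> ar c * ar b <> 0.
  by move=> h h'; apply: h; rewrite word_cons !scalerA mulrA h' mul0r scale0r.
exact: prev_uniq (nz2 _ _ _ awx) (nz2 _ _ _ awx').
Qed.

Lemma mark_free_path r N (x : N) :
  (forall y : N, mark r y -> y = 0) -> e v *: x = x -> x <> 0 ->
  exists2 w, size w = r & word w *: x <> 0.
Proof.
move=> free vx; apply: contra_notP => no; apply: free; right; split=> // w sw.
by apply: contra_notP no => wx; exists w.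
Qed.

Section Cyclic.
Context (r : nat) (N : lmodType L) (x : N) (p : seq (arrow Q)).
Hypothesis N_free : forall y : N, mark r y -> y = 0.
Hypothesis vx : e v *: x = x.
Hypothesis x_killed : forall w, size w = r.+1 -> word w *: x = 0.
Hypothesis size_p : size p = r.
Hypothesis px : word p *: x <> 0.

(* The nonzero words on x are exactly the suffixes of p, one for each length. *)
Let suf j := drop (r - j) p.
Let N_within : within N := mark_free_within N_free.

Let size_suf j : (j <= r)%N -> size (suf j) = j.
Proof. by move=> jr; rewrite size_drop size_p subKn. Qed.

Let p_split j : take (r - j) p ++ suf j = p.
Proof. exact: cat_take_drop. Qed.

Lemma long_killed w : (r < size w)%N -> word w *: x = 0.
Proof.
move=> rw; rewrite -(cat_take_drop (size w - r.+1) w) word_cat -scalerA.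
by rewrite x_killed ?scaler0 // size_drop subKn.
Qed.

Lemma suf_neq0 j : word (suf j) *: x <> 0.
Proof. by move=> h; apply: px; rewrite -(p_split j) word_cat -scalerA h scaler0. Qed.

Lemma scal_comm c l (P : lmodType L) (y : P) :
  l *: (kappa c *: y) = kappa c *: (l *: y).
Proof. by rewrite !scalerA kappaC. Qed.

Lemma scal_inj c (P : lmodType L) (y : P) : c != 0 -> kappa c *: y = 0 -> y = 0.
Proof.
move=> cn0 /(congr1 (fun z => kappa c^-1 *: z)).
by rewrite scalerA -rmorphM mulVf // rmorph1 scale1r scaler0.
Qed.

(** The coefficients do not depend on the module: this is what makes the cyclic
    module on [x] the largest one among those killed by words of length
    [r + 1]. *)
Lemma suffix_expansion l : exists c : nat -> K,
  forall (P : lmodType L) (z : P), within P -> e v *: z = z ->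
  (forall w, size w = r.+1 -> word w *: z = 0) ->
  l *: z = \sum_(j < r.+1) kappa (c j) *: (word (suf j) *: z).
Proof.
have zero : exists c : nat -> K,
    forall (P : lmodType L) (z : P),
    (0 : P) = \sum_(j < r.+1) kappa (c j) *: (word (suf j) *: z).
  by exists (fun _ => 0) => P z; rewrite big1 // => j _; rewrite rmorph0 scale0r.
have unit j0 : (j0 <= r)%N -> exists c : nat -> K,
    forall (P : lmodType L) (z : P),
    word (suf j0) *: z = \sum_(j < r.+1) kappa (c j) *: (word (suf j) *: z).
  move=> j0r; exists (fun j => (j == j0)%:R) => P z.
  rewrite (bigD1 (inord j0)) //= inordK // eqxx rmorph1 scale1r big1 ?addr0 //.
  move=> j; rewrite -val_eqE /= inordK // => /negPf ->.
  by rewrite rmorph0 scale0r.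
elim/L_ind: l => [|l l' [c IH] [c' IH']|d l [c IH]|u|w].
- by have [c h] := zero; exists c => P z *; rewrite scale0r -h.
- exists (fun j => c j + c' j) => P z *; rewrite scalerDl IH // IH' // -big_split.
  by apply: eq_bigr => j _; rewrite rmorphD scalerDl.
- exists (fun j => d * c j) => P z *; rewrite -scalerA IH // scaler_sumr.
  by apply: eq_bigr => j _; rewrite scalerA -rmorphM.
- have [->|uv] := eqVneq u v.
    have [c h] := unit 0%N isT; exists c => P z _ vz _.
    by rewrite -h vz /suf subn0 -size_p drop_size /word big_nil scale1r.
  have [c h] := zero; exists c => P z _ vz _.
  by rewrite -vz scalerA e_mul (negPf uv) scale0r -h.
have [/andP[wr /eqP ws]|n] := boolP ((size w <= r)%N && (w == suf (size w))).
  by have [c h] := unit _ wr; exists c => P z *; rewrite -h -ws.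
have [c h] := zero; exists c => P z inP vz z_killed; rewrite -h.
have [//|wz] := pselect (word w *: z = 0); case/negP: n; apply/andP.
have wr : (size w <= r)%N.
  rewrite leqNgt; apply/negP => rw; apply: wz.
  rewrite -(cat_take_drop (size w - r.+1) w) word_cat -scalerA.
  by rewrite z_killed ?scaler0 // size_drop subKn.
split=> //; apply/eqP; apply: word_uniq inP N_within vz vx _ wz (@suf_neq0 _).
by rewrite size_suf.
Qed.

(** The first part of [p] turns the suffix of length [j0] into [p], and all
    longer suffixes into words that kill [x]. *)
Lemma suffix_extract (c : nat -> K) j0 : (j0 <= r)%N ->
  (forall j, (j < j0)%N -> c j = 0) ->
  word (take (r - j0) p) *: (\sum_(j < r.+1) kappa (c j) *: (word (suf j) *: x)) =
  kappa (c j0) *: (word p *: x).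
Proof.
move=> j0r c0; rewrite scaler_sumr (bigD1 (inord j0)) //= !inordK //.
rewrite scal_comm (scalerA (word _)) -word_cat p_split big1 ?addr0 // => j.
rewrite -val_eqE /= inordK // => jj0; rewrite scal_comm.
have [/c0 ->|j0j] := ltnP j j0; first by rewrite rmorph0 scale0r.
have jr : (j <= r)%N by rewrite -ltnS.
rewrite (scalerA (word _)) -word_cat long_killed ?scaler0 // size_cat size_suf //.
rewrite size_takel ?size_p ?leq_subr // -{1}(subnK j0r) ltn_add2l.
by rewrite ltn_neqAle eq_sym jj0.
Qed.

Lemma suffix_free (c : nat -> K) :
  \sum_(j < r.+1) kappa (c j) *: (word (suf j) *: x) = 0 ->
  forall j, (j <= r)%N -> c j = 0.
Proof.
move=> s0; elim/ltn_ind => j IH jr; apply/eqP/negPn/negP => cj.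
apply/px/(scal_inj cj); rewrite -(@suffix_extract c j) ?s0 ?scaler0 // => i ij.
by apply: IH => //; rewrite ltnW // (leq_trans ij).
Qed.

(** Cyclic modules of the same kind are therefore quotients of the one on [x]. *)
Lemma annihilator_least l (P : lmodType L) (z : P) :
  within P -> e v *: z = z -> (forall w, size w = r.+1 -> word w *: z = 0) ->
  l *: x = 0 -> l *: z = 0.
Proof.
move=> inP vz zk; have [c h] := suffix_expansion l; rewrite !h //.
move/suffix_free => c0; apply: big1 => j _.
by rewrite c0 ?rmorph0 ?scale0r // -ltnS.
Qed.

(** A nonempty suffix of [p] that started at [v] would send [x] to a nonzero
    element at [v] killed by all words of length [r], and [N] has none. *)
Lemma suf_source i b t : (0 < i <= r)%N -> suf i = b :: t -> source b <> v.
Proof.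
move=> /andP[i0 ir] si bv; apply: (@suf_neq0 i); apply: N_free; right; split.
  by rewrite si word_cons -scalerA scalerA -bv e_source.
move=> w sw; rewrite scalerA -word_cat long_killed // size_cat size_suf // sw.
by rewrite -[X in (X < _)%N]addn0 ltn_add2l.
Qed.

Lemma suf_cons i : (i < r)%N -> exists b, suf i.+1 = b :: suf i.
Proof.
move=> ir; have [b _] : exists b, b \in p.
  by case: (p) size_p ir => [<-//|b ? *]; exists b; rewrite inE eqxx.
exists (nth b p (r - i.+1)); rewrite /suf (drop_nth b) ?size_p ?subnSK //.
exact: leq_subr.
Qed.

(** An arrow has at most one nonzero continuation, so two suffixes of [p] that
    follow the same arrow share their arrows until the shorter one is used up
    at [v]; the longer one then passes through [v] as well, which [suf_source]
    excludes. *)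
Lemma no_common_predecessor i j a : (j < i <= r)%N ->
  word (a :: suf i) <> 0 -> word (a :: suf j) *: x <> 0 -> False.
Proof.
elim: j i a => [|j IH] [|i] a //.
  move=> ir; have [|b sb] := @suf_cons i; first by case/andP: ir.
  move=> w0; rewrite word_cons -scalerA /suf subn0 -size_p drop_size.
  rewrite /word big_nil scale1r => /(ar_target vx) av.
  apply: (@suf_source i.+1 b (suf i)) => //.
  apply/esym; rewrite -av; apply/eqP/negPn/negP => /negPf n; apply: w0.
  rewrite sb !word_cons mulrA -(e_target a) -(e_source b) mulrA.
  by rewrite -(mulrA (ar a)) e_mul n mulr0 !mul0r.
rewrite ltnS => /andP[ji ir].
have [b sb] := suf_cons (ltn_trans ji ir); have [b' sb'] := suf_cons ir.
rewrite sb sb' !(word_cons _ (_ :: _)) -scalerA => w0 w1.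
have ab : ar a * ar b <> 0.
  by move=> h; apply: w1; rewrite word_cons !scalerA mulrA h mul0r scale0r.
have ab' : ar a * ar b' <> 0.
  by move=> h; apply: w0; rewrite word_cons mulrA h mul0r.
have bb := next_uniq ab ab'; apply: (IH i b); first by rewrite ji ltnW.
  by rewrite bb -sb' => h; apply: (@suf_neq0 i.+1); rewrite h scale0r.
by rewrite -sb; exact: suf_neq0.
Qed.

(** Elements at [v] marked modulo the cyclic module on [x] already belong to
    it. *)
Lemma generated_of_marked_mod (y : N) : e v *: y = y ->
  (forall w, size w = r -> exists l, word w *: y = l *: x) ->
  exists l, y = l *: x.
Proof.
move=> vy wy; have [l pyl] := wy p size_p.
have [c xc] := suffix_expansion l.
have {xc}pyc := etrans pyl (xc N x N_within vx x_killed).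
(* Subtracting a multiple of x leaves only proper suffixes of p. *)
pose y' := y - kappa (c r) *: x; pose c' j := if j == r then 0 else c j.
have [y0|yn0] := pselect (y' = 0).
  by exists (kappa (c r)); apply/eqP; rewrite -subr_eq0; apply/eqP.
have vy' : e v *: y' = y' by rewrite scalerBr scal_comm vx vy.
have py' : word p *: y' = \sum_(j < r.+1) kappa (c' j) *: (word (suf j) *: x).
  rewrite scalerBr pyc scal_comm [in LHS]big_ord_recr [in RHS]big_ord_recr /=.
  rewrite /suf subnn drop0 addrK /c' eqxx rmorph0 scale0r addr0.
  by apply: eq_bigr => j _; rewrite ltn_eqF.
have pyn0 : word p *: y' <> 0.
  have [w sw wy'n0] := mark_free_path N_free vy' yn0.
  by rewrite (word_uniq N_within N_within vx vy' _ px wy'n0) // size_p sw.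
have [j0 [j0r cj0 cmin]] : exists j0, [/\ (j0 <= r)%N, c' j0 != 0 &
    forall j, (j < j0)%N -> c' j = 0].
  have ex : exists j, (j <= r)%N && (c' j != 0).
    apply: contra_notP pyn0 => no; rewrite py' big1 // => j _.
    have [->|cj] := eqVneq (c' j) 0; first by rewrite rmorph0 scale0r.
    by case: no; exists j; rewrite cj andbT -ltnS.
  case: (ex_minnP ex) => j0 /andP[j0r cj0] minj; exists j0; split=> // j jj0.
  apply/eqP/negPn/negP => cj; have := minj j.
  by rewrite cj (ltnW (leq_trans jj0 j0r)) => /(_ isT); rewrite leqNgt jj0.
have j0lt : (j0 < r)%N.
  by rewrite ltn_neqAle j0r andbT; apply: contra_neq cj0; rewrite /c' => ->; rewrite eqxx.
have := suffix_extract j0r cmin; rewrite -py' scalerA -word_cat => key.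
(* Hence q p y' is nonzero for the part q of p before the suffix of length j0:
   the last arrow a of q is followed both by p and by that suffix. *)
have [q [a qa]] : exists q a, take (r - j0) p = rcons q a.
  have : size (take (r - j0) p) = (r - j0)%N by rewrite size_takel // size_p leq_subr.
  case: (lastP (take (r - j0) p)) => [|q a _]; last by exists q, a.
  by move/esym/eqP; rewrite subn_eq0 leqNgt j0lt.
exfalso; apply: (@no_common_predecessor r j0 a); first by rewrite j0lt leqnn.
  rewrite /suf subnn drop0 => h; apply/px/(scal_inj cj0).
  by rewrite -key qa cat_rcons word_cat h mulr0 scale0r.
move=> h; apply: px; rewrite -(p_split j0) qa cat_rcons word_cat -scalerA h.
exact: scaler0.
Qed.

End Cyclic.

Definition mark_class r : torsion_class L :=
  marked_torsion_class (@mark_hom r).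

Lemma mark_class_mono r : tors_le (mark_class r) (mark_class r.+1).
Proof.
move=> M [fg mk]; split=> // N f fs Nn0.
by have [x [xn0 /markS mx]] := mk N f fs Nn0; exists x.
Qed.

Lemma outside_cyclic r M (x : M) : outside x -> generates x -> mark_class r M.
Proof.
move=> xout gx; split; first exact: fg_cyclic gx.
move=> N f fs [y yn0]; exists (f x); split; last by left; exact: outside_hom.
move=> fx0; apply: yn0; have [z <-] := fs y; have [l ->] := gx z.
by rewrite linearZ /= fx0 scaler0.
Qed.

(** A marked element of the quotient at [v] comes from an element at [v] that is
    marked modulo the cyclic module on [x], and such elements belong to it. *)
Lemma mark_free_quotient r N (x : N) (P : lmodType L) (f : {linear N -> P}) :
  (forall y : N, mark r y -> y = 0) -> x <> 0 -> mark r.+1 x ->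
  (forall z, exists y, f y = z) -> (forall y, f y = 0 <-> exists l, y = l *: x) ->
  forall z : P, mark r z -> z = 0.
Proof.
move=> free xn0 mx fs ker z mz; have inN := mark_free_within free.
have [[u uW ux]|[vx xk]] := mx.
  by case: xn0; rewrite -ux inN.
have [y fy] := fs z; case: mz => [[u uW uz]|[vz wz]].
  by rewrite -uz -fy -linearZ inN // linear0.
have [p sp px] := mark_free_path free vx xn0.
have fvy : f (e v *: y) = z by rewrite linearZ fy.
rewrite -fvy; apply/ker.
apply: (generated_of_marked_mod free vx xk sp px).
  by rewrite scalerA e_mul eqxx.
by move=> w sw; apply/ker; rewrite linearZ /= fvy wz.
Qed.

(** The quotients by cyclic submodules remain without marked elements, so the
    process of dividing them out can only end at a cyclic module. *)
Lemma mark_free_cyclic r (Y : torsion_class L) d N :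
  tors_le Y (mark_class r.+1) -> spanned kappa N d -> Y N ->
  (exists y : N, y <> 0) -> (forall y : N, mark r y -> y = 0) ->
  exists M (x : M),
    [/\ Y M, generates x, x <> 0, mark r.+1 x & forall y : M, mark r y -> y = 0].
Proof.
move=> Yle; elim: d N => [|d IH] N sN YN Nn0 free.
  by case: Nn0 => y []; apply: spanned0 sN y.
have [fg mk] := Yle N YN.
have [|x [xn0 mx]] := mk N idfun _ Nn0; first by move=> y; exists y.
have [gx|nx] := pselect (generates x); first by exists N, x.
have [|a y z [b ->] [c ->]|P [f [fs ker]]] :=
    @quotient_exists L N (fun y => exists l, y = l *: x).
- by exists 0; rewrite scale0r.
- by exists (a * b + c); rewrite scalerDl scalerA.
apply: (IH P).
- apply: spanned_quotient fs sN xn0 _.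
  by apply/ker; exists 1; rewrite scale1r.
- exact: tors_quotient fs YN.
- move/existsNP: nx => [y ny]; exists (f y) => /ker; exact: ny.
- exact: mark_free_quotient free xn0 mx fs ker.
Qed.

(** A class between the two that is larger than the first contains the uniserial
    module C of length [r + 1], and every module of the second is filtered by
    quotients of C and modules with top outside [W]. *)
Lemma mark_class_cover r : no_class_between (mark_class r) (mark_class r.+1).
Proof.
move=> Y leY Yle.
have [|/existsNP [M /not_implyP [YM nM]]] := pselect (tors_le Y (mark_class r)).
  by left.
right; have fgM := tors_fg YM.
have [N [f [fs [Nn0 free]]]] : exists (N : lmodType L) (f : {linear M -> N}),
    (forall y, exists x, f x = y) /\
    ((exists y : N, y <> 0) /\ forall y : N, mark r y -> y = 0).
  apply: contra_notP nM => no; split=> // N f fs Nn0.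
  apply: contra_notP no => no'; exists N, f; split=> //; split=> // y my.
  by apply: contra_notP no' => yn0; exists y.
have YN : Y N := tors_quotient fs YM.
have [d sN] := finitely_spanned (tors_fg YN).
have [C [x [YC gx xn0 mx Cfree]]] := mark_free_cyclic Yle sN YN Nn0 free.
have inC := mark_free_within Cfree.
have [[u uW ux]|[vx xk]] := mx; first by case: xn0; rewrite -ux inC.
have [p sp px] := mark_free_path Cfree vx xn0.
move=> M' [fgM' mkM']; have [d' sM'] := finitely_spanned fgM'.
apply: (tors_mem_filtered sM') => N' f' fs' N'n0.
have [z [zn0 mz]] := mkM' N' f' fs' N'n0.
have [[u [uW [l ulz]]]|no] :=
    pselect (exists u, u \notin W /\ exists l, e u *: (l *: z) <> 0).
  have [A [i [xi [inj ixi gxi]]]] := cyclic_submodule_exists (e u *: (l *: z)).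
  exists A, i; split=> //.
    by exists xi => xi0; apply: ulz; rewrite -ixi xi0 linear0.
  apply: leY; apply: outside_cyclic gxi; exists u => //.
  by apply: inj; rewrite linearZ ixi /= scalerA e_mul eqxx.
(* The submodule on z vanishes outside W, so it is a quotient of C. *)
have [A [i [xi [inj ixi gxi]]]] := cyclic_submodule_exists z.
have inA : within A.
  move=> u y uW; have [l ->] := gxi y; apply: inj.
  rewrite !linearZ linear0 /= ixi.
  by apply: contra_notP no => h; exists u; split=> //; exists l.
exists A, i; split=> //.
  by exists xi => xi0; apply: zn0; rewrite -ixi xi0 linear0.
have [vxi xik] : e v *: xi = xi /\ forall w, size w = r.+1 -> word w *: xi = 0.
  case: mz => [[u uW uz]|[vz zk]].
    by case: zn0; rewrite -uz -ixi -linearZ inA // linear0.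
  split=> [|w sw]; apply: inj; rewrite linearZ /= ixi //.
  by rewrite zk // linear0.
have [l|g gE] := @cyclic_map_exists L C A x xi gx.
  exact: (annihilator_least Cfree vx xk sp px inA vxi xik).
apply: (tors_quotient (f := g)) YC => y; have [l ->] := gxi y.
by exists (l *: x).
Qed.

End Step.

(** The modules with top outside [W]. *)
Definition vertex_class (W : {set vertex Q}) : torsion_class L :=
  marked_torsion_class (@outside_hom W).

Lemma mark_class0 (W : {set vertex Q}) v : mark_class W v 0 = vertex_class W.
Proof.
apply: tors_le_antisym => M [fg mk]; split=> // N f fs Nn0;
  have [x [xn0 mx]] := mk N f fs Nn0; exists x; split=> //; last by left.
case: mx => // -[_ /(_ [::] erefl)]; by rewrite /word big_nil scale1r.
Qed.

Lemma mark_class_last (W : {set vertex Q}) v :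
  v \in W -> mark_class W v m = vertex_class (W :\ v).
Proof.
move=> vW; apply: tors_le_antisym => M [fg mk]; split=> // N f fs Nn0;
  have [x [xn0 mx]] := mk N f fs Nn0; exists x; split=> //.
  case: mx => [[u uW ux]|[vx _]]; last by exists v; rewrite // !inE eqxx.
  by exists u; rewrite // !inE (negPf uW) andbF.
case: mx => u; rewrite !inE negb_and negbK => /orP [/eqP -> vx|uW ux].
  by right; split=> // w wm; rewrite word_nilp ?wm // scale0r.
by left; exists u.
Qed.

(** One vertex after the other is removed from [W], each removal passing through
    the classes [mark_class W v r] for [r] from 0 to the nilpotency bound. *)
Lemma vertex_class_chain :
  (forall v : vertex Q, (degree v <= 3)%N) ->
  forall W, cover_chain (vertex_class set0) (vertex_class W).
Proof.
move=> deg3 W; have [n Wn] := ubnP #|W|; elim: n W Wn => // n IH W.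
have [-> _|Wn0 Wn] := eqVneq W set0; first exact: CoverChainNil.
have [v vW v_in] := vertex_with_few_incoming deg3 Wn0.
have steps k : (k <= m)%N -> cover_chain (vertex_class set0) (mark_class W v (m - k)).
  elim: k => [_|k IHk km].
    rewrite subn0 mark_class_last //; apply: IH.
    by move: Wn; rewrite (cardsD1 v W) vW.
  apply: (@CoverChainStep L _ _ (mark_class W v (m - k.+1).+1)).
  - exact: mark_class_mono.
  - exact: mark_class_cover.
  - by rewrite subnSK //; apply: IHk; exact: ltnW.
by have := steps m (leqnn m); rewrite subnn mark_class0.
Qed.

Lemma string_presentation_mgs :
  (forall v : vertex Q, (degree v <= 3)%N) -> has_maximal_green_sequence L.
Proof.
move=> deg3; apply: cover_chain_has_mgs (vertex_class_chain deg3 setT).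
  move=> Z M [fg mk]; apply: tors_zero => x.
  apply: contra_notP (_ : ~ False) => // xn0.
  have [|//|y [_ [u]]] := mk M idfun; [by move=> y; exists y|by exists x|].
  by rewrite inE.
move=> Z M ZM; split; first exact: tors_fg ZM.
move=> N f fs [y yn0].
have [u uy] : exists u, e u *: y <> 0.
  apply: contra_notP yn0 => no.
  rewrite -[y]scale1r -sum_e scaler_suml big1 // => u _.
  by apply: contra_notP no => h; exists u.
exists (e u *: y); split=> //; exists u; rewrite ?inE //.
by rewrite scalerA e_mul eqxx.
Qed.

End StringPresentation.

(** * The classes of paths in a bound quiver algebra *)

Section BoundQuiverAlgebra.
Context (K : fieldType) (Q : quiver) (I : twoSidedIdeal (path_algebra Q K)).
Local Notation L := (quotient_ring I).
Implicit Types (u v : vertex Q) (a b : arrow Q) (w : seq (arrow Q)).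

Definition class_of (x : path_algebra Q K) : L := (\pi_(quotient_ring I) x)%qT.

Lemma class_ofD x y : class_of (x + y) = class_of x + class_of y.
Proof. by rewrite [RHS]pi_qadd. Qed.
Lemma class_ofM x y : class_of (x * y) = class_of x * class_of y.
Proof. by rewrite [RHS]pi_qmul. Qed.
Lemma class_of1 : class_of 1 = 1. Proof. by []. Qed.
Lemma class_of_eq0 x : class_of x = 0 <-> x \in I.
Proof.
have e0 : class_of 0 = 0 by apply: (addrI (class_of 0)); rewrite -class_ofD !addr0.
by rewrite -e0 -{2}(subr0 x); exact: qpiE.
Qed.
Lemma class_of0 : class_of 0 = 0.
Proof. by apply/class_of_eq0; exact: rpred0. Qed.

Definition scalar (c : K) : L := class_of (c *: (1 : path_algebra Q K)).

Lemma scalar_mul c x : scalar c * class_of x = class_of (c *: x).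
Proof. by rewrite -class_ofM [_ * _]pa_mulZl [pa_mul _ _]pa_mul1l. Qed.

Lemma scalarC c (l : L) : scalar c * l = l * scalar c.
Proof.
elim/quotW: l => x; rewrite -[(\pi x)%qT]/(class_of x) scalar_mul -class_ofM.
by rewrite [_ * _]pa_mulZr [pa_mul _ _]pa_mul1r.
Qed.

Let scalar_zmod : zmod_morphism scalar.
Proof.
move=> c d; rewrite /scalar scalerBl class_ofD; congr (_ + _).
apply: (addrI (class_of (d *: (1 : path_algebra Q K)))).
by rewrite -class_ofD !subrr class_of0.
Qed.
Let scalar_monoid : monoid_morphism scalar.
Proof.
split=> [|c d]; first by rewrite /scalar scale1r.
by rewrite scalar_mul /scalar scalerA.
Qed.
HB.instance Definition _ := GRing.isZmodMorphism.Build K L scalar scalar_zmod.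
HB.instance Definition _ := GRing.isMonoidMorphism.Build K L scalar scalar_monoid.

Definition vertex_elt v : L := class_of (path_elt K (trivial_path v)).
Definition arrow_class a : L := class_of (arrow_elt K a).

Lemma sum_vertex_elt : \sum_v vertex_elt v = 1.
Proof.
by rewrite -class_of1 [1]/(pa_one Q K) (big_morph _ class_ofD class_of0).
Qed.

Lemma vertex_elt_mul u v :
  vertex_elt u * vertex_elt v = if u == v then vertex_elt u else 0.
Proof.
rewrite -class_ofM [_ * _]pa_mulpp /path_mul; case: pcatP => [r uv ru _ rl|].
  rewrite [u == v](introT eqP uv); congr (class_of (path_elt K _)).
  exact: qpath_eq.
by move/negPf; rewrite [pend _ == _]/(u == v) => ->; rewrite class_of0.
Qed.

Lemma vertex_elt_source a : vertex_elt (source a) * arrow_class a = arrow_class a.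
Proof.
rewrite -class_ofM [_ * _]pa_mulpp /path_mul; case: pcatP; last by rewrite eqxx.
by move=> r _ ru _ rl; congr (class_of (path_elt K _)); exact: qpath_eq.
Qed.

Lemma vertex_elt_target a : arrow_class a * vertex_elt (target a) = arrow_class a.
Proof.
rewrite -class_ofM [_ * _]pa_mulpp /path_mul; case: pcatP; last by rewrite eqxx.
by move=> r _ ru _ rl; congr (class_of (path_elt K _)); exact: qpath_eq.
Qed.

Lemma path_elt_prod v w (vw : is_walk v w) : w <> [::] ->
  path_elt K (exist (fun x : vertex Q * seq (arrow Q) => is_walk x.1 x.2) (v, w) vw)
  = \prod_(a <- w) arrow_elt K a.
Proof.
elim: w v vw => // a w IH v vw _; rewrite big_cons.
have /andP[/eqP av aw] : (source a == v) && is_walk (target a) w := vw.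
have [w0|/IH wP] := pselect (w = [::]).
  rewrite [in RHS]w0 big_nil mulr1; congr path_elt.
  apply: qpath_eq; first exact/esym.
  by rewrite /parrows /= w0.
rewrite -(wP _ aw) [RHS]pa_mulpp /path_mul; case: pcatP; last by rewrite eqxx.
by move=> r _ ru _ rl; congr path_elt; apply: qpath_eq; rewrite ?ru ?rl.
Qed.

Lemma class_of_word w : class_of (\prod_(a <- w) arrow_elt K a) = word arrow_class w.
Proof. by rewrite /word (big_morph _ class_ofM class_of1). Qed.

Lemma bound_quiver_ind (P : L -> Prop) :
  P 0 -> (forall x y, P x -> P y -> P (x + y)) ->
  (forall c x, P x -> P (scalar c * x)) ->
  (forall v, P (vertex_elt v)) -> (forall w, P (word arrow_class w)) ->
  forall x, P x.
Proof.
move=> P0 PD PZ Pv Pw; elim/quotW => x; rewrite -[(\pi x)%qT]/(class_of x).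
elim/pa_ind: x => [|x y Px Py|c p].
- by rewrite class_of0.
- by rewrite class_ofD; exact: PD.
rewrite -scalar_mul; apply: PZ.
have [p0|] := pselect (parrows p = [::]).
  by rewrite (@qpath_eq Q p (trivial_path (pstart p)) erefl p0); exact: Pv.
by case: p => [[v w] vw] wn0; rewrite path_elt_prod // class_of_word; exact: Pw.
Qed.

Lemma arrow_word_nilpotent : admissible I ->
  exists m, forall w, (m <= size w)%N -> word arrow_class w = 0.
Proof.
move=> [[m [_ powI]] _]; exists m => w wm; rewrite -(cat_take_drop m w).
rewrite /word big_cat -/(word _ _) -class_of_word /=.
rewrite (_ : class_of _ = 0) ?mul0r //; apply/class_of_eq0/powI.
have sm : size (take m w) = m by rewrite size_takel.
move=> J; apply; case: m sm {wm powI} => [|m] sm.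
  by exists (fun _ => 0); split=> [[]//|]; rewrite big_ord0 (size0nil sm) big_nil.
have [a0 _] : exists a0, a0 \in take m.+1 w.
  by case: (take _ _) sm => // a *; exists a; rewrite inE eqxx.
exists (fun i => arrow_elt K (nth a0 (take m.+1 w) i)); split.
  by move=> i J' inJ'; apply: inJ'; eexists.
by rewrite (big_nth a0) sm big_mkord.
Qed.

Lemma arrow_class_mul_neq0 a b :
  arrow_class a * arrow_class b <> 0 -> arrow_elt K a * arrow_elt K b \notin I.
Proof. by move=> n; apply/negP => /class_of_eq0; rewrite class_ofM. Qed.

End BoundQuiverAlgebra.

Theorem corollary4p8 (K : closedFieldType) (Q : quiver)
    (I : twoSidedIdeal (path_algebra Q K)) :
  string_algebra I ->
  (forall v : vertex Q, (degree v <= 3)%N) ->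
  has_maximal_green_sequence (quotient_ring I).
Proof.
move=> [/arrow_word_nilpotent [m nilp] _ _ next prev].
apply: (@string_presentation_mgs K (quotient_ring I) Q m (@scalar K Q I)
  (@vertex_elt K Q I) (@arrow_class K Q I) (@scalarC K Q I)
  (@sum_vertex_elt K Q I) (@vertex_elt_mul K Q I) (@vertex_elt_source K Q I)
  (@vertex_elt_target K Q I) nilp _ _ (@bound_quiver_ind K Q I)).
- by move=> a b b' /arrow_class_mul_neq0 ab /arrow_class_mul_neq0; exact: next.
- by move=> a c c' /arrow_class_mul_neq0 ab /arrow_class_mul_neq0; exact: prev.
Qed.
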